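(* Let $\mathcal R=\langle S\mid R\rangle$ be a finitely presented rack with $S=\{x_1,\dots,x_g\}$, and let $M$ be a run limit (a positive integer). Suppose that ENUMERATE$(S,R,M)$ completes, and let $\mathcal E=(\omega,A,\tau,\rho)$ be the returned table with set of live elements $\Omega$. For every $j\in\Omega$ there exist $k\in\Omega\cap\{1,\dots,g\}$ and $w\in F(S)$ with $j=k^w$; define for $i,j\in\Omega$ $$i^j=i^{\bar w x_k w},\qquad i^{\bar j}=i^{\bar w\bar x_k w},$$ where $k\in\Omega\cap\{1,\dots,g\}$ and $w\in F(S)$ are any such that $j=k^w$. Then $\Omega$ with these two operations ($i\rhd j=i^j$ and $i\rhd^{-1}j=i^{\bar j}$) is a rack, and $\tau:\Omega\to\mathcal R$ is a rack isomorphism.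
   Context: RACKS AND PRESENTATIONS. A rack is a set with two binary operations $\rhd,\rhd^{-1}$ such that $(x\rhd y)\rhd^{-1}y=(x\rhd^{-1}y)\rhd y=x$ and $(x\rhd y)\rhd z=(x\rhd z)\rhd(y\rhd z)$ for all $x,y,z$. Write $x^y=x\rhd y$, $x^{\bar y}=x\rhd^{-1}y$; a word in the exponent acts letter by letter from left to right. $F(S)$ is the free group on $S$, and $\bar w$ denotes the inverse of $w\in F(S)$; $\bar S=\{\bar x: x\in S\}$. The free rack $FR(S)$ is the set of symbols $a^w$ ($a\in S$, $w\in F(S)$), with $a^u=b^v$ iff $a=b$ in $S$ and $u=v$ in $F(S)$, and operations $a^u\rhd b^v=a^{u\bar v b v}$, $a^u\rhd^{-1}b^v=a^{u\bar v\bar b v}$. Given $S=\{x_1,\dots,x_g\}$ and a finite set $R$ of pairs $(x_i^{u},x_j)$, written $x_i^u=x_j$, with $x_i,x_j\in S$ and $u$ a reduced word in $F(S)$ (primary relations), $\mathcal R=\langle S\mid R\rangle$ is the quotient of $FR(S)$ by the smallest congruence (equivalence relation respecting both operations) containing $R$. TABLES. An enumeration table for $\mathcal R$ is $\mathcal E=(\omega,A,\tau,\rho)$, where $\omega$ is the number of rows, $A$ is a partial function $\{1,\dots,\omega\}\times(S\cup\bar S)\to\{1,\dots,\omega\}$ (write $i^y$ for $A(i,y)$, possibly undefined), $\tau:\{1,\dots,\omega\}\to\mathcal R$ and $\rho:\{1,\dots,\omega\}\to\{1,\dots,\omega\}$ are functions, and $\rho(i)\le i$ for all $i$. For a word $w=y_1\cdots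 y_t$, $j^w=k$ means that the successive entries $j_0=j$, $j_s=j_{s-1}^{y_s}$ are all defined and $j_t=k$. The live elements are $\Omega=\{i:1\le i\le\omega,\ \rho(i)=i\}$ (always with respect to the current table). $\mathcal E$ is complete if $i^y$ is defined for all $i\in\Omega$, $y\in S\cup\bar S$. REP$(i)$ is the least element of $\{\rho^t(i):t\ge0\}$, obtained by iterating $\rho$ until a fixed point is reached. ALGORITHMS (all act on the current table). INIT: $\omega:=g$, $A$ empty, $\tau(i):=x_i$ and $\rho(i):=i$ for $1\le i\le g$; $R_2$ (secondary relations) is the set of reduced forms of the words $\bar u x_i u\bar x_j$ for $x_i^u=x_j$ in $R$. DEFINE$(i,y)$: $\omega:=\omega+1$; $i^y:=\omega$; $\omega^{\bar y}:=i$; $\tau(\omega):=\tau(i)^y$; $\rho(\omega):=\omega$. DEDUCTION$(i,y,j)$: $i^y:=j$; $j^{\bar y}:=i$. SCAN$(i,w,j)$ with $w=y_1\cdots y_t$ reduced: set $f:=1$, $b:=t$, $k:=i$, $\ell:=j$. While $f\le b$, repeat the following (so nothing is done if $w$ is the empty word): while $f\le b$ and $k^{y_f}$ is defined, set $k:=k^{y_f}$, $f:=f+1$; then while $f\le b$ and $\ell^{\bar y_b}$ is defined, set $\ell:=\ell^{\bar y_b}$, $b:=b-1$; then, if $f<b$, call DEFINE$(k,y_f)$; else if $f=b$, call DEDUCTION$(k,y_f,\ell)$ and break from the outer loop; else (now $b<f$) if $k\ne\ell$, call COINCIDENCE$(k,\ell)$; else break from the outer loop. UPDATE$(i)$: set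 $\rho(j):=$ REP$(i)$ for all $j$ in $\{\rho^t(i):t\ge0\}$. MERGE$(m,n)$ (with a queue $Q$): $\mu:=$ REP$(m)$, $\nu:=$ REP$(n)$; if $\mu\ne\nu$, append $\max(\mu,\nu)$ to $Q$ and set $\rho(\max(\mu,\nu)):=\min(\mu,\nu)$. COINCIDENCE$(m,n)$: let $Q$ be empty; call MERGE$(m,n)$. Process the elements $d$ of $Q$ in order (including those appended meanwhile) until all are processed: for each $x\in S\cup\bar S$, if $d^x$ is defined, say $d^x=e$, then: undefine $d^x$ and $e^{\bar x}$; set $\delta:=$ REP$(d)$, UPDATE$(d)$; $\epsilon:=$ REP$(e)$, UPDATE$(e)$; if $\delta^x$ is defined, MERGE$(\epsilon,\delta^x)$; else if $\epsilon^{\bar x}$ is defined, MERGE$(\delta,\epsilon^{\bar x})$; else set $\delta^x:=\epsilon$, $\epsilon^{\bar x}:=\delta$. ENUMERATE$(S,R,M)$: run INIT. For each $x_i^u=x_j$ in $R$, call SCAN$($REP$(i),u,$REP$(j))$. Set $i:=1$. While $i\le\max(\Omega)$ and $i\le M$: (1) for each $w\in R_2$, if $i\in\Omega$ call SCAN$(i,w,i)$, otherwise break off this loop over $R_2$; (2) if $i\in\Omega$, for each $y\in S\cup\bar S$ with $i^y$ undefined call DEFINE$(i,y)$; (3) $i:=i+1$. After the loop, if $i>\max(\Omega)$ return $\mathcal E$, which is then a complete table (in this case the process is said to complete); otherwise return ''run limit exceeded''.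
   Formalization: The formal theorem assumes that a primary relation x_i^u = x_j with u the empty word has i = j; otherwise SCAN ignores it and τ can fail to be injective, e.g. for S={x_1,x_2}, R={x_1=x_2, x_1^{x_1}=x_1, x_2^{x_2}=x_2}. *)

(* Defs.v *)
From HB Require Import structures.
From mathcomp Require Import all_boot.
From mathcomp Require Import generic_quotient finmap boolp.

Set Implicit Arguments.
Unset Strict Implicit.
Unset Printing Implicit Defensive.

Local Open Scope group_scope.
Local Open Scope quotient_scope.

Record is_rack (T : Type) (op opi : T -> T -> T) : Prop := IsRack {
  rack_opK : forall x y, opi (op x y) y = x;
  rack_opiK : forall x y, op (opi x y) y = x;
  rack_opD : forall x y z, op (op x y) z = op (op x z) (op y z)
}.

Record is_rack_isomorphism (T U : Type) (opT opiT : T -> T -> T)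
    (opU opiU : U -> U -> U) (f : T -> U) : Prop := IsRackIsomorphism {
  rack_iso_bij : bijective f;
  rack_iso_op : {morph f : x y / opT x y >-> opU x y};
  rack_iso_opi : {morph f : x y / opiT x y >-> opiU x y}
}.

(* The letter (k, false) is the generator x_k, and (k, true) is its inverse. *)
Definition letter (g : nat) : Type := ('I_g * bool)%type.
HB.instance Definition _ g := Finite.on (letter g).

Definition linv g (y : letter g) : letter g := (y.1, ~~ y.2).

Definition reduced g (w : seq (letter g)) : bool :=
  sorted (fun y z => z != linv y) w.

Definition cons_reduced g (y : letter g) (w : seq (letter g)) :=
  if w is z :: w' then if z == linv y then w' else y :: w else [:: y].

Definition reduce g (w : seq (letter g)) : seq (letter g) :=
  foldr (@cons_reduced g) [::] w.

Definition winv g (w : seq (letter g)) : seq (letter g) := rev (map (@linv g) w).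

Record fgroup (g : nat) := FGroup {
  fgval :> seq (letter g);
  _ : reduced fgval
}.

HB.instance Definition _ g := [isSub for @fgval g].
HB.instance Definition _ g := [Choice of fgroup g by <:].

Section FreeGroup.
Variable g : nat.
Implicit Types (y : letter g) (w u v : seq (letter g)).

Lemma linvK : involutive (@linv g).
Proof. by case=> k b; rewrite /linv negbK. Qed.

Lemma reduced_cons y w : reduced (y :: w) -> reduced w.
Proof. by case: w => //= z w /andP[]. Qed.

Lemma cons_reducedP y w : reduced w -> reduced (cons_reduced y w).
Proof.
case: w => //= z w rw; case: ifP => [_|/negbT yz]; first exact: reduced_cons rw.
by rewrite /reduced /= yz.
Qed.

Lemma reduceP w : reduced (reduce w).
Proof. by elim: w => //= y w IHw; apply: cons_reducedP. Qed.

Lemma reduce_id w : reduced w -> reduce w = w.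
Proof.
elim: w => //= y w IHw rw; rewrite IHw ?(reduced_cons rw) //.
by case: w rw {IHw} => //= z w /andP[/negbTE ->].
Qed.

Lemma cons_reducedK y w :
  reduced w -> cons_reduced y (cons_reduced (linv y) w) = w.
Proof.
case: w => [|z w] rw /=; first by rewrite eqxx.
rewrite linvK; case: eqP rw => [-> rw|_ _] /=; last by rewrite eqxx.
by case: w rw => //= t w /andP[/negbTE ->].
Qed.

Let actw u v := foldr (@cons_reduced g) v u.

Lemma actwP u v : reduced v -> reduced (actw u v).
Proof. by move=> rv; elim: u => //= y u IHu; apply: cons_reducedP. Qed.

Lemma actw_cons y u v :
  reduced v -> actw (cons_reduced y u) v = cons_reduced y (actw u v).
Proof.
move=> rv; case: u => //= z u; case: eqP => [->|//].
by rewrite cons_reducedK // actwP.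
Qed.

Lemma reduce_cat u v : reduce (u ++ v) = actw u (reduce v).
Proof. by rewrite /reduce foldr_cat. Qed.

Lemma actw_reduce u v : reduced v -> actw (reduce u) v = actw u v.
Proof. by move=> rv; elim: u => //= y u IHu; rewrite actw_cons // IHu. Qed.

Lemma reduce_catl u v : reduce (reduce u ++ v) = reduce (u ++ v).
Proof. by rewrite !reduce_cat actw_reduce // reduceP. Qed.

Lemma reduce_catr u v : reduce (u ++ reduce v) = reduce (u ++ v).
Proof. by rewrite !reduce_cat (reduce_id (reduceP v)). Qed.

Lemma reduced_winv w : reduced w -> reduced (winv w).
Proof.
rewrite /reduced /winv rev_sorted sorted_map; apply: sub_sorted => y z /=.
by rewrite linvK eq_sym.
Qed.

Lemma reduce_winvl w : reduce (winv w ++ w) = [::].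
Proof.
elim: w => // y w IHw; rewrite /winv /= rev_cons cat_rcons -/(winv w).
rewrite reduce_cat /= -[y in cons_reduced y (reduce w)]linvK.
by rewrite cons_reducedK ?reduceP // -reduce_cat.
Qed.

Lemma winvK w : winv (winv w) = w.
Proof. by rewrite /winv map_rev revK mapK //; apply: linvK. Qed.

Lemma reduce_winvr w : reduce (w ++ winv w) = [::].
Proof. by rewrite -{1}(winvK w) reduce_winvl. Qed.

Definition fg_of w : fgroup g := FGroup (reduceP w).
Definition fg_one : fgroup g := FGroup (isT : reduced [::]).
Definition fg_mul (u v : fgroup g) : fgroup g := fg_of (u ++ v).
Definition fg_inv (u : fgroup g) : fgroup g := FGroup (reduced_winv (valP u)).

Lemma fg_mulA : associative fg_mul.
Proof. by move=> u v w; apply: val_inj; rewrite /= reduce_catr reduce_catl catA. Qed.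

Lemma fg_mul1 : left_id fg_one fg_mul.
Proof. by move=> u; apply: val_inj; rewrite /= reduce_id // (valP u). Qed.

Lemma fg_mulr1 : right_id fg_one fg_mul.
Proof. by move=> u; apply: val_inj; rewrite /= cats0 reduce_id // (valP u). Qed.

Lemma fg_mulV : left_inverse fg_one fg_inv fg_mul.
Proof. by move=> u; apply: val_inj; rewrite /= reduce_winvl. Qed.

Lemma fg_mulrV : right_inverse fg_one fg_inv fg_mul.
Proof. by move=> u; apply: val_inj; rewrite /= reduce_winvr. Qed.

End FreeGroup.

HB.instance Definition _ g :=
  isGroup.Build (fgroup g) (@fg_mulA g) (@fg_mul1 g) (@fg_mulr1 g)
    (@fg_mulV g) (@fg_mulrV g).

Definition fgen g (k : 'I_g) : fgroup g := fg_of [:: (k, false)].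

(* The pair (a, w) is the symbol a^w. *)
Definition free_rack (g : nat) : Type := ('I_g * fgroup g)%type.
HB.instance Definition _ g := Choice.on (free_rack g).

Definition fr_op g (x y : free_rack g) : free_rack g :=
  (x.1, x.2 * y.2^-1 * fgen y.1 * y.2).
Definition fr_opi g (x y : free_rack g) : free_rack g :=
  (x.1, x.2 * y.2^-1 * (fgen y.1)^-1 * y.2).
Definition fr_gen g (k : 'I_g) : free_rack g := (k, 1).

Lemma free_rackP g : is_rack (@fr_op g) (@fr_opi g).
Proof.
split=> [[a u] [b v]|[a u] [b v]|[a u] [b v] [c w]];
  rewrite /fr_op /fr_opi /= ?invgM ?invgK ?mulgA;
  by rewrite ?(mulgK, mulgVK).
Qed.

(* The pair (x_i^u, x_j) is the primary relation x_i^u = x_j. *)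
Definition relation (g : nat) : Type := (free_rack g * 'I_g)%type.
HB.instance Definition _ g := Choice.on (relation g).

Definition rel_src g (r : relation g) : 'I_g := r.1.1.
Definition rel_word g (r : relation g) : fgroup g := r.1.2.
Definition rel_tgt g (r : relation g) : 'I_g := r.2.

Record is_congruence (T : Type) (op opi : T -> T -> T) (C : T -> T -> Prop) :
    Prop := IsCongruence {
  cong_refl : forall x, C x x;
  cong_sym : forall x y, C x y -> C y x;
  cong_trans : forall y x z, C x y -> C y z -> C x z;
  cong_op : forall x x' y y', C x x' -> C y y' -> C (op x y) (op x' y');
  cong_opi : forall x x' y y', C x x' -> C y y' -> C (opi x y) (opi x' y')
}.

Definition pres_cong g (R : {fset relation g}) (x y : free_rack g) : Prop :=
  forall C : free_rack g -> free_rack g -> Prop,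
    is_congruence (@fr_op g) (@fr_opi g) C ->
    (forall r, r \in R -> C r.1 (fr_gen (rel_tgt r))) ->
    C x y.

Section PresentedRack.
Variables (g : nat) (R : {fset relation g}).

Lemma pres_cong_congruence :
  is_congruence (@fr_op g) (@fr_opi g) (pres_cong R).
Proof.
split=> [x|x y xy|y x z xy yz|x x' y y' xx yy|x x' y y' xx yy] C CC CR.
- exact: cong_refl CC _.
- exact: (cong_sym CC (xy C CC CR)).
- exact: (cong_trans CC (xy C CC CR) (yz C CC CR)).
- exact: (cong_op CC (xx C CC CR) (yy C CC CR)).
- exact: (cong_opi CC (xx C CC CR) (yy C CC CR)).
Qed.

Definition pres_rel (x y : free_rack g) : bool := `[< pres_cong R x y >].

Lemma pres_rel_refl : reflexive pres_rel.
Proof. by move=> x; apply/asboolP; apply: (cong_refl pres_cong_congruence). Qed.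

Lemma pres_rel_sym : symmetric pres_rel.
Proof.
by move=> x y; apply/asboolP/asboolP => h;
  apply: (cong_sym pres_cong_congruence h).
Qed.

Lemma pres_rel_trans : transitive pres_rel.
Proof.
move=> y x z /asboolP xy /asboolP yz; apply/asboolP.
exact: (cong_trans pres_cong_congruence xy yz).
Qed.

Canonical pres_equiv := EquivRel pres_rel pres_rel_refl pres_rel_sym pres_rel_trans.

Definition presented : Type := {eq_quot pres_equiv}.
HB.instance Definition _ := Choice.on presented.
HB.instance Definition _ := EqQuotient.on presented.

Definition pres_op : presented -> presented -> presented :=
  lift_op2 presented (@fr_op g).
Definition pres_opi : presented -> presented -> presented :=
  lift_op2 presented (@fr_opi g).
Definition pres_gen (k : 'I_g) : presented := \pi_presented (fr_gen k).

Lemma pres_piP (x y : free_rack g) :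
  \pi_presented x = \pi_presented y <-> pres_cong R x y.
Proof. by split=> [/eqmodP/asboolP|h] //; apply/eqmodP/asboolP. Qed.

Lemma pi_pres_op :
  {morph \pi_presented : x y / fr_op x y >-> pres_op x y}.
Proof.
move=> x y; unlock pres_op; apply/pres_piP.
by apply: (cong_op pres_cong_congruence); apply/pres_piP; rewrite reprK.
Qed.

Lemma pi_pres_opi :
  {morph \pi_presented : x y / fr_opi x y >-> pres_opi x y}.
Proof.
move=> x y; unlock pres_opi; apply/pres_piP.
by apply: (cong_opi pres_cong_congruence); apply/pres_piP; rewrite reprK.
Qed.

Lemma presentedP : is_rack pres_op pres_opi.
Proof.
have [opK opiK opD] := free_rackP g.
split=> [x y|x y|x y z].
- by rewrite -[x]reprK -[y]reprK -pi_pres_op -pi_pres_opi opK.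
- by rewrite -[x]reprK -[y]reprK -pi_pres_opi -pi_pres_op opiK.
- by rewrite -[x]reprK -[y]reprK -[z]reprK -!pi_pres_op opD.
Qed.

Definition pres_act (x : presented) (y : letter g) : presented :=
  if y.2 then pres_opi x (pres_gen y.1) else pres_op x (pres_gen y.1).

End PresentedRack.

Definition secondary g (R : {fset relation g}) : {fset fgroup g} :=
  [fset (rel_word r)^-1 * fgen (rel_src r) * rel_word r * (fgen (rel_tgt r))^-1
     | r in R]%fset.

Local Open Scope nat_scope.

(* Rows are numbered from 1, so that row k.+1 belongs to the generator k : 'I_g.
   The field entry is A; entry and tau are None outside their domains; rho is only
   meaningful on 1, ..., omega. *)
Record table (g : nat) (R : {fset relation g}) := Table {
  omega : nat;
  entry : nat * letter g -> option nat;
  tau : nat -> option (presented R);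
  rho : nat -> nat
}.

Section Enumeration.
Variables (g : nat) (R : {fset relation g}).
Implicit Types (E : table R) (y : letter g) (w : seq (letter g)).

Definition live E (i : nat) : bool := (0 < i <= omega E) && (rho E i == i).

Definition max_live E : nat := \max_(i < (omega E).+1 | live E i) i.

(* [trace E j w = Some k] means j^w = k. *)
Definition trace E (j : nat) w : option nat :=
  foldl (fun oi y => obind (fun i => entry E (i, y)) oi) (Some j) w.

(* The orbit {rho^t(i) : t >= 0}: since rho j <= j, the iterates of rho are
   stationary after at most i steps; see [rho_orbitP]. *)
Definition rho_orbit E (i : nat) : seq nat := traject (rho E) i i.+1.

Definition REP E (i : nat) : nat := \big[minn/i]_(j <- rho_orbit E i) j.

Lemma rho_orbitP E i : (forall j, rho E j <= j) ->
  forall j, (j \in rho_orbit E i) <-> (exists t, j = iter t (rho E) i).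
Proof.
move=> le_rho j; split=> [/trajectP[t _ ->]|[t ->{j}]]; first by exists t.
suff fixn n k : k <= n -> rho E (iter n (rho E) k) = iter n (rho E) k.
  apply/loopingP; rewrite /looping iterS fixn //.
  by apply/trajectP; exists i.
elim: n k => [|n IHn] k le_kn.
  by apply/eqP; move: le_kn (le_rho k); rewrite /= leqn0 => /eqP->; rewrite leqn0.
rewrite iterSr; have [fix_k|nfix_k] := eqVneq (rho E k) k.
  by rewrite fix_k iter_fix.
by apply: IHn; rewrite -ltnS; apply: leq_trans le_kn; rewrite ltn_neqAle nfix_k le_rho.
Qed.

Lemma REP_least E i : (forall j, rho E j <= j) ->
  (exists t, REP E i = iter t (rho E) i) /\
  (forall t, REP E i <= iter t (rho E) i).
Proof.
move=> le_rho; rewrite /REP; split.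
  apply/rho_orbitP => //; rewrite big_seq.
  elim/big_ind: _ => [|m n|//]; first by rewrite /rho_orbit mem_head.
  by rewrite /minn; case: ifP.
move=> t; have := (rho_orbitP i le_rho (iter t (rho E) i)).2 (ex_intro _ t erefl).
elim: (rho_orbit E i) => //= j s IHs; rewrite big_cons in_cons geq_min.
by case/predU1P=> [->|/IHs->]; rewrite ?leqnn ?orbT.
Qed.

Definition set_entry E (a : nat * letter g) (o : option nat) : table R :=
  Table (omega E) [eta entry E with a |-> o] (tau E) (rho E).

Definition set_rho E (r : nat -> nat) : table R :=
  Table (omega E) (entry E) (tau E) r.

Definition init : table R :=
  Table g (fun=> None)
    (fun i => if i is k.+1 then omap (@pres_gen g R) (insub k) else None) id.

Definition deduction E (i : nat) y (j : nat) : table R :=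
  set_entry (set_entry E (i, y) (Some j)) (j, linv y) (Some i).

Definition define E (i : nat) y : table R :=
  let n := (omega E).+1 in
  deduction
    (Table n (entry E)
       [eta tau E with n |-> omap (fun t => pres_act t y) (tau E i)]
       [eta rho E with n |-> n])
    i y n.

Definition update E (i : nat) : table R :=
  set_rho E (fun j => if j \in rho_orbit E i then REP E i else rho E j).

(* The queue is appended to on the right and consumed from the left. *)
Definition merge (EQ : table R * seq nat) (m n : nat) : table R * seq nat :=
  let: (E, Q) := EQ in
  let mu := REP E m in
  let nu := REP E n in
  if mu != nu then
    (set_rho E [eta rho E with maxn mu nu |-> minn mu nu], rcons Q (maxn mu nu))
  else (E, Q).

Definition coincidence_letter (d : nat) (EQ : table R * seq nat) (x : letter g) :
    table R * seq nat :=
  let: (E, Q) := EQ in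
  if entry E (d, x) is Some e then
    let E1 := set_entry (set_entry E (d, x) None) (e, linv x) None in
    let delta := REP E1 d in
    let E2 := update E1 d in
    let eps := REP E2 e in
    let E3 := update E2 e in
    if entry E3 (delta, x) is Some c then merge (E3, Q) eps c
    else if entry E3 (eps, linv x) is Some c then merge (E3, Q) delta c
    else (deduction E3 delta x eps, Q)
  else (E, Q).

(* The algorithm does not prescribe the order in which its loops over finite
   sets run: each time, any duplicate-free listing of the set may be used. *)
Definition listing (T : eqType) (P : pred T) (s : seq T) : Prop :=
  uniq s /\ forall x, (x \in s) = P x.

Inductive coincidence_loop : table R * seq nat -> table R -> Prop :=
| CoincidenceDone E : coincidence_loop (E, [::]) E
| CoincidenceNext E d Q s E' of
    listing predT s &
    coincidence_loop (foldl (coincidence_letter d) (E, Q) s) E' :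
  coincidence_loop (E, d :: Q) E'.

Definition coincidence E (m n : nat) (E' : table R) : Prop :=
  coincidence_loop (merge (E, [::]) m n) E'.

(* In SCAN the indices f and b enter only through the word v = y_f ... y_b that
   remains to be read: f <= b, f < b and f = b say that v is nonempty, has
   length at least 2 and has length 1. *)
Fixpoint scan_forward E (k : nat) (v : seq (letter g)) : nat * seq (letter g) :=
  if v is y :: v' then
    if entry E (k, y) is Some k' then scan_forward E k' v' else (k, v)
  else (k, v).

Definition scan_backward E (v : seq (letter g)) (l : nat) :
    seq (letter g) * nat :=
  let: (l', v') := scan_forward E l (winv v) in (winv v', l').

Inductive scan_loop : table R -> nat -> seq (letter g) -> nat -> table R -> Prop :=
| ScanEnd E k l : scan_loop E k [::] l E
| ScanDefine E k v l k1 v1 y z v2 l2 E' of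
    v != [::] &
    scan_forward E k v = (k1, v1) &
    scan_backward E v1 l = ([:: y, z & v2], l2) &
    scan_loop (define E k1 y) k1 [:: y, z & v2] l2 E' :
  scan_loop E k v l E'
| ScanDeduction E k v l k1 v1 y l2 of
    v != [::] &
    scan_forward E k v = (k1, v1) &
    scan_backward E v1 l = ([:: y], l2) :
  scan_loop E k v l (deduction E k1 y l2)
| ScanCoincidence E k v l k1 v1 l2 E' of
    v != [::] &
    scan_forward E k v = (k1, v1) &
    scan_backward E v1 l = ([::], l2) &
    k1 != l2 &
    coincidence E k1 l2 E' :
  scan_loop E k v l E'
| ScanClosed E k v l k1 v1 l2 of
    v != [::] &
    scan_forward E k v = (k1, v1) &
    scan_backward E v1 l = ([::], l2) &
    k1 = l2 :
  scan_loop E k v l E.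

Definition scan E (i : nat) (w : fgroup g) (j : nat) (E' : table R) : Prop :=
  scan_loop E i w j E'.

Inductive scan_primary : seq (relation g) -> table R -> table R -> Prop :=
| PrimaryDone E : scan_primary [::] E E
| PrimaryNext r s E E1 E2 of
    scan E (REP E (rel_src r).+1) (rel_word r) (REP E (rel_tgt r).+1) E1 &
    scan_primary s E1 E2 :
  scan_primary (r :: s) E E2.

Inductive scan_secondary (i : nat) :
    seq (fgroup g) -> table R -> table R -> Prop :=
| SecondaryDone E : scan_secondary i [::] E E
| SecondaryBreak (w : fgroup g) s E of ~~ live E i : scan_secondary i (w :: s) E E
| SecondaryNext (w : fgroup g) s E E1 E2 of
    live E i & scan E i w i E1 & scan_secondary i s E1 E2 :
  scan_secondary i (w :: s) E E2.

Definition define_missing (i : nat) (E : table R) (s : seq (letter g)) : table R :=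
  foldl (fun E y => if entry E (i, y) is None then define E i y else E) E s.

Inductive main_loop (M : nat) : nat -> table R -> nat -> table R -> Prop :=
| MainExit i E of ~~ ((i <= max_live E) && (i <= M)) : main_loop M i E i E
| MainNext i E s t E1 i' E' of
    i <= max_live E &
    i <= M &
    listing (fun w : fgroup g => w \in secondary R) s &
    scan_secondary i s E E1 &
    listing predT t &
    main_loop M i.+1 (if live E1 i then define_missing i E1 t else E1) i' E' :
  main_loop M i E i' E'.

(* Some run of ENUMERATE(S, R, M) completes and returns E. *)
Definition enumerate_completes (M : nat) (E : table R) : Prop :=
  exists s E1 i,
    [/\ listing (fun r => r \in R) s, scan_primary s init E1,
        main_loop M 1 E1 i E & max_live E < i].

Definition live_row E : Type := {i : nat | live E i}.

End Enumeration.

(* Main.v *)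
Require Import Defs.
From mathcomp Require Import all_boot finmap generic_quotient.
From mathcomp Require Import zify.

Set Implicit Arguments.
Unset Strict Implicit.
Unset Printing Implicit Defensive.

(** Two things only grow during a run: the identifications of rows, given by
    equality of [REP], and the set of entries read modulo these identifications
    ([qedge]).  A coincidence erases entries, but makes up for each of them by
    identifying rows or by adding an entry with the same reading.  Hence a path that closes up once ([qpath]) closes up
    for ever; this is [refines], proved for each operation in turn.  Rows also
    keep their meaning: [sound] says in particular that an entry i^y = j forces
    tau j = (tau i)^y and that [rho] preserves [tau].  It survives coincidences
    because a scan only identifies rows whose values agree in the presented
    rack, where x_i^u = x_j and where secondary words act trivially
    ([pres_rel_word], [pres_secondary_word]).

    When the process completes, dead rows have no entries and every live row has
    been treated, so F(S) acts on the live rows, each primary relation holds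
    between the rows of its generators, and secondary words fix every live row
    ([enumerated]).

    What remains is to see that [tau] is injective on live rows, and that the
    operation is well defined.  Send the symbol a^u of the free rack to the live
    row obtained from the row of a by the word u ([row]), and to the word
    u^-1 a u ([rack_word]), by which the free rack acts on rows.  Calling two
    symbols congruent when their rows are equal and their words act equally on
    all live rows gives a congruence ([row_congP]).  It contains each primary
    relation: the rows agree because the relation was scanned, and the words act
    equally because they differ by a secondary word.  So it contains the
    defining congruence of the presented rack; thus [row] descends to the
    presented rack, where it is inverse to [tau], and the action of the word of
    a row depends on that row alone.  The rack axioms are then transported along
    [tau]. *)

(** * Words acting on the presented rack *)

Section Words.
Variables (g : nat) (R : {fset relation g}).
Implicit Types (y : letter g) (u v w : seq (letter g)) (t : presented R).

Lemma winv_cat u v : winv (u ++ v) = winv v ++ winv u.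
Proof. by rewrite /winv map_cat rev_cat. Qed.

Lemma winv_cons y w : winv (y :: w) = winv w ++ [:: linv y].
Proof. by rewrite -cat1s winv_cat. Qed.

Definition pres_act_word t w : presented R := foldl (@pres_act g R) t w.

Lemma pres_act_word_cat t u v :
  pres_act_word t (u ++ v) = pres_act_word (pres_act_word t u) v.
Proof. exact: foldl_cat. Qed.

Lemma pres_actK t y : pres_act (pres_act t y) (linv y) = t.
Proof.
have [opK opiK _] := presentedP R.
by case: y => k [] /=; rewrite /pres_act /= ?opK ?opiK.
Qed.

Lemma fg_of_cat u v : fg_of (u ++ v) = (fg_of u * fg_of v)%g.
Proof. by apply: val_inj; rewrite /= reduce_catl reduce_catr. Qed.

Lemma fg_of_val (w : fgroup g) : fg_of w = w.
Proof. by apply: val_inj; rewrite /= reduce_id // (valP w). Qed.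

Lemma fg_of_letter y :
  fg_of [:: y] = (if y.2 then (fgen y.1)^-1 else fgen y.1)%g.
Proof. by case: y => k []; apply: val_inj. Qed.

Lemma pres_act_pi (x : free_rack g) y :
  pres_act (\pi_(presented R) x)%qT y
    = (\pi_(presented R) (x.1, (x.2 * fg_of [:: y])%g))%qT.
Proof.
rewrite fg_of_letter /pres_act /pres_gen -pi_pres_op -pi_pres_opi.
rewrite /fr_op /fr_opi /= invg1 !mulg1.
by case: ifP.
Qed.

Lemma pres_act_word_pi (x : free_rack g) w :
  pres_act_word (\pi_(presented R) x)%qT w
    = (\pi_(presented R) (x.1, (x.2 * fg_of w)%g))%qT.
Proof.
elim: w x => [|y w IHw] x.
  have -> : fg_of [::] = 1%g :> fgroup g by apply: val_inj.
  by rewrite mulg1 -surjective_pairing.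
by rewrite /= pres_act_pi IHw -mulgA -fg_of_cat.
Qed.

Lemma pres_act_word_gen k (w : fgroup g) :
  pres_act_word (pres_gen R k) w = (\pi_(presented R) (k, w))%qT.
Proof. by rewrite pres_act_word_pi fg_of_val /= mul1g. Qed.

Lemma pres_rel_word r : r \in R ->
  pres_act_word (pres_gen R (rel_src r)) (rel_word r)
    = pres_gen R (rel_tgt r).
Proof.
move=> rR; rewrite pres_act_word_gen; apply/pres_piP => C CC CR.
by have := CR r rR; case: r {rR} => [[a u] b].
Qed.

(** Acting by x_i^u and by x_j is the same when x_i^u = x_j, and acting by x_i^u
    is acting by the word u^-1 x_i u. *)
Lemma pres_secondary_word (w : fgroup g) t :
  w \in secondary R -> pres_act_word t w = t.
Proof.
case/imfsetP=> /= r rR ->; rewrite -[t]reprK; set x := repr t.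
have [opK _ _] := presentedP R.
rewrite pres_act_word_pi fg_of_val.
rewrite -[RHS](opK _ (pres_gen R (rel_tgt r))).
rewrite -{1}pres_rel_word // pres_act_word_gen -pi_pres_op -pi_pres_opi.
by rewrite /fr_opi /fr_op /= invg1 !mulg1 !mulgA.
Qed.

End Words.

(** * Representatives and entries modulo coincidence *)

Section Tables.
Variables (g : nat) (R : {fset relation g}).
Implicit Types (E : table R) (y : letter g) (w : seq (letter g)).

Section Rep.
Variable E : table R.
Hypothesis rho_le : forall i, rho E i <= i.

Lemma rho_REP i : rho E (REP E i) = REP E i.
Proof.
have [[t REPt] min_REP] := REP_least i rho_le.
apply/eqP; rewrite eqn_leq rho_le {2}REPt.
by rewrite -[rho E _]/(iter t.+1 (rho E) i) min_REP.
Qed.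

Lemma REP_rho i : REP E (rho E i) = REP E i.
Proof.
have [[t REPt] min_REP] := REP_least i rho_le.
have [[s REPs] min_REPr] := REP_least (rho E i) rho_le.
apply/eqP; rewrite eqn_leq {2}REPs -iterSr min_REP andbT.
rewrite -[REP E i]rho_REP REPt -[X in _ <= X]/(iter t.+1 (rho E) i).
by rewrite iterSr min_REPr.
Qed.

Lemma REP_iter t i : REP E (iter t (rho E) i) = REP E i.
Proof. by elim: t => //= t <-; rewrite REP_rho. Qed.

Lemma REP_fixed i : rho E i = i -> REP E i = i.
Proof. by have [[t ->] _] := REP_least i rho_le; apply: iter_fix. Qed.

Lemma REPK i : REP E (REP E i) = REP E i.
Proof. by rewrite REP_fixed // rho_REP. Qed.

Lemma REP_le i : REP E i <= i.
Proof. by have [_ /(_ 0)] := REP_least i rho_le. Qed.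

Lemma REP_orbit i j : j \in rho_orbit E i -> REP E j = REP E i.
Proof. by case/trajectP=> t _ ->; rewrite REP_iter. Qed.

(** Every later computation of [REP] after a change of [rho] goes through this
    characterization, which avoids looking at the iterates. *)
Lemma REP_unique (f : nat -> nat) :
  (forall i, f (rho E i) = f i) -> (forall i, rho E i = i -> f i = i) ->
  forall i, REP E i = f i.
Proof.
move=> f_rho f_fix i; rewrite -[LHS]f_fix ?rho_REP //.
have [[t ->] _] := REP_least i rho_le.
by elim: t => //= t; rewrite f_rho.
Qed.

Lemma REP_invariant (T : Type) (f : nat -> T) :
  (forall i, f (rho E i) = f i) -> forall i, f (REP E i) = f i.
Proof.
move=> f_rho i; have [[t ->] _] := REP_least i rho_le.
by elim: t => //= t; rewrite f_rho.
Qed.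

End Rep.

(** An entry of the quotient of the table by [REP].  Processing a coincidence
    erases and moves entries, but loses none of the quotient. *)
Definition qedge E a y b : Prop :=
  exists a' b', [/\ REP E a' = REP E a, REP E b' = REP E b
                  & entry E (a', y) = Some b'].

Fixpoint qpath E a w b : Prop :=
  if w is y :: w' then exists2 c, qedge E a y c & qpath E c w' b
  else REP E a = REP E b.

(** The part of the invariant that holds at every moment, even in the middle of
    a coincidence: inverse letters have inverse entries, and [tau] is an
    equivariant labelling of the rows that is constant on coincidence classes. *)
Record sound E : Prop := Sound {
  rho_le : forall i, rho E i <= i;
  rho_gt0 : forall i, 0 < i -> 0 < rho E i;
  rho_out : forall i, omega E < i -> rho E i = i;
  entry_sym : forall i y j,
    entry E (i, y) = Some j -> entry E (j, linv y) = Some i;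
  entry_range : forall i y j, entry E (i, y) = Some j -> 0 < i <= omega E;
  gens_range : g <= omega E;
  tau_gen : forall k : 'I_g, tau E k.+1 = Some (pres_gen R k);
  tau_row : forall i, 0 < i <= omega E -> tau E i;
  tau_entry : forall i y j, entry E (i, y) = Some j ->
    tau E j = omap (fun t => pres_act t y) (tau E i);
  tau_rho : forall i, tau E (rho E i) = tau E i
}.

(** Monotonicity along a run.  [refines_reach] is what links each row to a
    generator at the end, since the initial rows are those of the generators. *)
Record refines E E' : Prop := Refines {
  refines_omega : omega E <= omega E';
  refines_fixed : forall i, rho E' i = i -> rho E i = i;
  refines_REP : forall i j, REP E i = REP E j -> REP E' i = REP E' j;
  refines_qedge : forall a y b, qedge E a y b -> qedge E' a y b;
  refines_reach : forall i, 0 < i <= omega E' ->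
    exists j w, 0 < j <= omega E /\ qpath E' j w i
}.

Lemma entry_qedge E a y b : entry E (a, y) = Some b -> qedge E a y b.
Proof. by exists a, b. Qed.

Lemma qedge_REP E a b y a' b' : REP E a = REP E a' -> REP E b = REP E b' ->
  qedge E a y b -> qedge E a' y b'.
Proof. by move=> ea eb [c [d [ec ed e]]]; exists c, d; rewrite ec ed. Qed.

Lemma qpath_REP E a b w a' b' : REP E a = REP E a' -> REP E b = REP E b' ->
  qpath E a w b -> qpath E a' w b'.
Proof.
move=> ea eb; elim: w a a' ea => /= [|y w IHw] a a' ea; first by rewrite ea eb.
move=> [c ac cb]; exists c; first exact: qedge_REP ac.
exact: IHw cb.
Qed.

Lemma qpath_cat E a b c u v :
  qpath E a u b -> qpath E b v c -> qpath E a (u ++ v) c.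
Proof.
elim: u a => /= [|y u IHu] a; first by move=> ab; apply: qpath_REP.
by move=> [d ad db] bc; exists d => //; apply: IHu.
Qed.

Lemma trace_cat E j u v :
  trace E j (u ++ v) = obind (fun i => trace E i v) (trace E j u).
Proof.
by rewrite /trace foldl_cat; case: (foldl _ _ u) => [a|] //=; elim: v.
Qed.

Lemma trace_cons E j y w :
  trace E j (y :: w) = obind (fun i => trace E i w) (entry E (j, y)).
Proof. by rewrite -cat1s trace_cat. Qed.

Lemma trace_qpath E a w b : trace E a w = Some b -> qpath E a w b.
Proof.
elim: w a => [|y w IHw] a; first by case=> <-.
rewrite trace_cons; case e: (entry _ _) => [c|//] /= cb.
by exists c; [apply: entry_qedge | apply: IHw].
Qed.

Lemma qedge_sym E a y b : sound E -> qedge E a y b -> qedge E b (linv y) a.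
Proof. by move=> sE [a' [b' [ea eb /(entry_sym sE)]]]; exists b', a'. Qed.

Lemma refines_qpath E E' a w b : refines E E' -> qpath E a w b -> qpath E' a w b.
Proof.
move=> EE'; elim: w a => /= [|y w IHw] a; first exact: refines_REP.
by move=> [c ac cb]; exists c; [apply: refines_qedge ac | apply: IHw].
Qed.

Lemma refines_refl E : refines E E.
Proof. by split=> // i i_row; exists i, [::]. Qed.

Lemma refines_trans E2 E1 E3 : refines E1 E2 -> refines E2 E3 -> refines E1 E3.
Proof.
move=> r12 r23; split.
- exact: leq_trans (refines_omega r12) (refines_omega r23).
- by move=> i /(refines_fixed r23)/(refines_fixed r12).
- by move=> i j /(refines_REP r12)/(refines_REP r23).
- by move=> a y b /(refines_qedge r12)/(refines_qedge r23).
move=> i /(refines_reach r23)[j [w [/(refines_reach r12)[k [v [k1 kj]]] ji]]].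
by exists k, (v ++ w); split=> //; apply: qpath_cat ji; apply: refines_qpath kj.
Qed.

Lemma refines_same_rows E E' : omega E' = omega E ->
  (forall i, rho E' i = i -> rho E i = i) ->
  (forall i j, REP E i = REP E j -> REP E' i = REP E' j) ->
  (forall a y b, entry E (a, y) = Some b -> qedge E' a y b) -> refines E E'.
Proof.
move=> eomega fixed REP_mono edge; split=> //; first by rewrite eomega.
  move=> a y b [a' [b' [ea eb /edge]]].
  by apply: qedge_REP; apply: REP_mono.
by move=> i; rewrite eomega => i_row; exists i, [::].
Qed.

Lemma entry_range_tgt E i y j :
  sound E -> entry E (i, y) = Some j -> 0 < j <= omega E.
Proof. by move=> sE /(entry_sym sE)/(entry_range sE). Qed.

Lemma REP_range E i : sound E -> 0 < i <= omega E -> 0 < REP E i <= omega E.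
Proof.
move=> sE /andP[i_gt0 i_le]; rewrite (leq_trans (REP_le (rho_le sE) i) i_le).
rewrite andbT; have [[t ->] _] := REP_least i (rho_le sE).
by elim: t => //= t /(rho_gt0 sE).
Qed.

Lemma tau_REP E i : sound E -> tau E (REP E i) = tau E i.
Proof. by move=> sE; apply: (REP_invariant (rho_le sE)); apply: tau_rho. Qed.

Lemma tau_entry_rev E i y j : sound E -> entry E (i, y) = Some j ->
  tau E i = omap (fun t => pres_act t (linv y)) (tau E j).
Proof. by move=> sE /(entry_sym sE)/(tau_entry sE). Qed.

(** * Soundness and monotonicity of the elementary operations *)

Lemma update_rho_le E i : sound E -> forall j, rho (update E i) j <= j.
Proof.
move=> sE j /=; case: ifP => [/(REP_orbit (rho_le sE)) <-|_].
  exact: REP_le (rho_le sE) _.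
exact: (rho_le sE).
Qed.

Lemma REP_update E i j : sound E -> REP (update E i) j = REP E j.
Proof.
move=> sE; apply: REP_unique => {j}; first exact: update_rho_le.
- move=> j /=; case: ifP => [/(REP_orbit (rho_le sE)) ->|_].
    exact: REPK (rho_le sE) _.
  exact: REP_rho (rho_le sE) _.
- move=> j /=; case: ifP => [/(REP_orbit (rho_le sE)) -> //|_].
  exact: REP_fixed (rho_le sE) _.
Qed.

Lemma update_fixed E i j : sound E -> (rho (update E i) j = j) <-> (rho E j = j).
Proof.
move=> sE /=; case: ifP => // /(REP_orbit (rho_le sE)) <-.
by split=> [<-|/(REP_fixed (rho_le sE)) //]; apply: rho_REP (rho_le sE) _.
Qed.

Lemma sound_update E i : sound E -> sound (update E i).
Proof.
move=> sE; split=> /=.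
- exact: update_rho_le.
- move=> j j_gt0; case: ifP => [/(REP_orbit (rho_le sE)) <-|_].
    have [[t ->] _] := REP_least j (rho_le sE).
    by elim: t => //= t /(rho_gt0 sE).
  exact: (rho_gt0 sE).
- by move=> j j_out; apply/(update_fixed i j sE)/rho_out.
- exact: (entry_sym sE).
- exact: (entry_range sE).
- exact: (gens_range sE).
- exact: (tau_gen sE).
- exact: (tau_row sE).
- exact: (tau_entry sE).
- move=> j; case: ifP => [/(REP_orbit (rho_le sE)) <-|_]; first exact: tau_REP.
  exact: (tau_rho sE).
Qed.

(** The fourth clause is the bookkeeping of the queue: a row that stops being a
    fixed point of [rho] is queued. *)
Lemma mergeP E Q m n E' Q' : sound E ->
  0 < m <= omega E -> 0 < n <= omega E -> tau E m = tau E n ->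
  Defs.merge (E, Q) m n = (E', Q') ->
  [/\ sound E', refines E E', REP E' m = REP E' n,
      (forall i, rho E i = i \/ i \in Q -> rho E' i = i \/ i \in Q') &
      entry E' = entry E].
Proof.
move=> sE m_row n_row tau_mn; rewrite /Defs.merge.
have REPK_E := REPK (rho_le sE).
case: eqVneq => [eq_mn|neq_mn] [<- <-].
  by split=> //; apply: refines_refl.
set mx := maxn _ _; set mn := minn _ _; set E1 := set_rho _ _.
have [REPmx REPmn] : REP E mx = mx /\ REP E mn = mn.
  by rewrite /mx /mn /maxn /minn; case: ifP; rewrite !REPK_E.
have tau_mx : tau E mn = tau E mx.
  have: tau E (REP E m) = tau E (REP E n) by rewrite !tau_REP.
  by rewrite /mx /mn /maxn /minn; case: ifP.
have lt_mn_mx : mn < mx by move: neq_mn; rewrite /mn /mx; lia.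
have mx_fixed : rho E mx = mx by rewrite -{1}REPmx (rho_REP (rho_le sE)) REPmx.
have mx_row : 0 < mx <= omega E.
  by rewrite /mx /maxn; case: ifP => _; apply: REP_range.
have mn_row : 0 < mn <= omega E.
  by rewrite /mn /minn; case: ifP => _; apply: REP_range.
have rhoE1 i : rho E1 i = if i == mx then mn else rho E i by [].
have rho_le1 i : rho E1 i <= i.
  by rewrite rhoE1; case: eqP => [->|_]; [apply: ltnW | apply: rho_le].
have REP1 i : REP E1 i = if REP E i == mx then mn else REP E i.
  pose f i := if REP E i == mx then mn else REP E i.
  apply: (@REP_unique E1 rho_le1 f); rewrite /f.
    move=> {}i; rewrite rhoE1; case: (eqVneq i mx) => [->|_].
      by rewrite REPmn REPmx eqxx (ltn_eqF lt_mn_mx).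
    by rewrite (REP_rho (rho_le sE)).
  move=> {}i; rewrite rhoE1; case: (eqVneq i mx) => [->|i_mx].
    by move=> e; move: lt_mn_mx; rewrite e ltnn.
  by move=> /(REP_fixed (rho_le sE)) ->; rewrite (negbTE i_mx).
have fixed1 i : rho E1 i = i -> rho E i = i.
  by rewrite rhoE1; case: eqP => [-> //|].
split=> //.
- split=> //.
  + move=> i i_gt0; rewrite rhoE1; case: eqP => _; last exact: rho_gt0.
    by case/andP: mn_row.
  + move=> i /= i_out; case: eqP => [e|_]; last exact: (rho_out sE).
    by move: i_out mx_row; rewrite e => /[swap]/andP[_]; rewrite leqNgt => /negP.
  + exact: (entry_sym sE).
  + exact: (entry_range sE).
  + exact: (gens_range sE).
  + exact: (tau_gen sE).
  + exact: (tau_row sE).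
  + exact: (tau_entry sE).
  + move=> i; rewrite rhoE1 -/(tau E); case: eqP => [->|_]; first exact: tau_mx.
    exact: (tau_rho sE).
- apply: refines_same_rows => //; first by move=> i j; rewrite !REP1 => ->.
  by move=> a y b e; apply: entry_qedge.
- rewrite !REP1 /mx /mn /maxn /minn; case: (_ < _).
    by rewrite (negbTE neq_mn) eqxx.
  by rewrite eqxx eq_sym (negbTE neq_mn).
move=> i; rewrite rhoE1 mem_rcons in_cons.
by case: (eqVneq i mx) => _; [right | ].
Qed.

Lemma merge_omega E Q m n E' Q' :
  Defs.merge (E, Q) m n = (E', Q') -> omega E' = omega E.
Proof. by rewrite /Defs.merge; case: ifP => _ [<- _]. Qed.

Lemma set_entryE E a o b : entry (set_entry E a o) b = if b == a then o else entry E b.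
Proof. by []. Qed.

Definition undefine E i y j : table R :=
  set_entry (set_entry E (i, y) None) (j, linv y) None.

Lemma linv_neq y : (linv y == y) = false.
Proof. by case: y => k []; rewrite /linv xpair_eqE /= andbF. Qed.

Lemma undefine_entry E i y j a z : entry (undefine E i y j) (a, z) =
  if (a == j) && (z == linv y) || (a == i) && (z == y) then None else entry E (a, z).
Proof. by rewrite !set_entryE !xpair_eqE; case: andP. Qed.

Lemma sound_undefine E i y j : sound E -> entry E (i, y) = Some j ->
  sound (undefine E i y j).
Proof.
move=> sE ij; have ji := entry_sym sE ij.
have sub a z b : entry (undefine E i y j) (a, z) = Some b -> entry E (a, z) = Some b.
  by rewrite undefine_entry; case: ifP.
split.
- exact: (rho_le sE).
- exact: (rho_gt0 sE).
- exact: (rho_out sE).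
- move=> a z b e; have ab := sub _ _ _ e; have ba := entry_sym sE ab.
  move: e; rewrite !undefine_entry; case: ifP => // /norP[n1 n2] _.
  case: ifP => // /orP[] /andP[/eqP eb /eqP ez].
    case/negP: n2; move: ba; rewrite eb ez ji => -[->].
    by rewrite -[z]linvK ez linvK !eqxx.
  case/negP: n1; move: ba; rewrite eb ez ij => -[->].
  by rewrite -ez linvK !eqxx.
- by move=> a z b /sub/(entry_range sE).
- exact: (gens_range sE).
- exact: (tau_gen sE).
- exact: (tau_row sE).
- by move=> a z b /sub/(tau_entry sE).
- exact: (tau_rho sE).
Qed.

Lemma deduction_entry E i y j a z : entry (deduction E i y j) (a, z) =
  if (a == j) && (z == linv y) then Some i
  else if (a == i) && (z == y) then Some j else entry E (a, z).
Proof. by rewrite !set_entryE !xpair_eqE. Qed.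

Lemma deduction_edge E i y j : entry (deduction E i y j) (i, y) = Some j.
Proof.
by rewrite deduction_entry !eqxx [y == _]eq_sym linv_neq andbF.
Qed.

Lemma deduction_sub E i y j a z b :
  entry E (i, y) = None -> entry E (j, linv y) = None ->
  entry E (a, z) = Some b -> entry (deduction E i y j) (a, z) = Some b.
Proof.
move=> iy jy ab; rewrite deduction_entry.
case: andP => [[/eqP ea /eqP ez]|_]; first by move: ab; rewrite ea ez jy.
by case: andP => [[/eqP ea /eqP ez]|_] //; move: ab; rewrite ea ez iy.
Qed.

Lemma sound_deduction E i y j : sound E ->
  0 < i <= omega E -> 0 < j <= omega E ->
  entry E (i, y) = None -> entry E (j, linv y) = None ->
  tau E j = omap (fun t => pres_act t y) (tau E i) -> sound (deduction E i y j).
Proof.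
move=> sE i_row j_row iy jy tau_ij.
split.
- exact: (rho_le sE).
- exact: (rho_gt0 sE).
- exact: (rho_out sE).
- move=> a z b; rewrite [entry _ (a, z)]deduction_entry.
  case: andP => [[/eqP-> /eqP->] [<-]|_]; first by rewrite linvK deduction_edge.
  case: andP => [[/eqP-> /eqP->] [<-]|_]; first by rewrite deduction_entry !eqxx.
  by move=> /(entry_sym sE); apply: deduction_sub.
- move=> a z b; rewrite deduction_entry.
  case: andP => [[/eqP-> _] //|_]; case: andP => [[/eqP-> _] //|_].
  exact: (entry_range sE).
- exact: (gens_range sE).
- exact: (tau_gen sE).
- exact: (tau_row sE).
- move=> a z b; rewrite deduction_entry.
  case: andP => [[/eqP-> /eqP->] [<-]|_] /=.
    by rewrite tau_ij; case: (tau E i) => //= t; rewrite pres_actK.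
  case: andP => [[/eqP-> /eqP->] [<-] //|_]; exact: (tau_entry sE).
- exact: (tau_rho sE).
Qed.

Lemma refines_deduction E i y j :
  entry E (i, y) = None -> entry E (j, linv y) = None ->
  refines E (deduction E i y j).
Proof.
move=> iy jy; apply: refines_same_rows => // a z b ab.
by apply: entry_qedge; apply: deduction_sub ab.
Qed.

Lemma entry_out E i y : sound E -> omega E < i -> entry E (i, y) = None.
Proof.
move=> sE i_out; case e: entry => [j|//].
by have := entry_range sE e; rewrite [i <= _]leqNgt i_out andbF.
Qed.

(** Outside of a coincidence, dead rows are empty; by [entry_sym] no entry then
    leads to a dead row either. *)
Definition live_entries E : Prop := forall i y, entry E (i, y) -> rho E i = i.

(** The first half of [define]: the row is created before it is linked, so that
    the rest is a [deduction]. *)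
Definition new_row E i y : table R :=
  let n := (omega E).+1 in
  Table n (entry E) [eta tau E with n |-> omap (fun t => pres_act t y) (tau E i)]
    [eta rho E with n |-> n].

Lemma new_row_rho E i y : sound E -> rho (new_row E i y) =1 rho E.
Proof. by move=> sE j /=; case: eqP => [->|//]; rewrite rho_out. Qed.

Lemma REP_eq E E' : (forall i, rho E i <= i) -> rho E' =1 rho E -> REP E' =1 REP E.
Proof.
move=> le_rho eq_rho; apply: REP_unique => i; rewrite eq_rho //.
- exact: REP_rho.
- exact: REP_fixed.
Qed.

Lemma sound_new_row E i y : sound E -> 0 < i <= omega E -> sound (new_row E i y).
Proof.
move=> sE i_row; have rhoE := new_row_rho i y sE.
have tauE j : j <= omega E -> tau (new_row E i y) j = tau E j.
  by move=> j_le /=; rewrite ltn_eqF.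
split=> [j|j|j|||||||].
- by rewrite rhoE rho_le.
- by rewrite rhoE; apply: rho_gt0.
- by move=> j_out; rewrite rhoE rho_out // ltnW.
- exact: (entry_sym sE).
- by move=> a z b /(entry_range sE)/andP[-> /leqW].
- exact: leqW (gens_range sE).
- move=> k; rewrite tauE ?tau_gen //.
  exact: leq_trans (ltn_ord k) (gens_range sE).
- move=> j /=; case: eqP => [-> _|]; last first.
    move=> /eqP n1 /andP[j1 j2]; apply: tau_row => //.
    by rewrite j1 -ltnS ltn_neqAle n1.
  by have := tau_row sE i_row; case: (tau E i).
- move=> a z b ab; have /andP[_ a_le] := entry_range sE ab.
  have /andP[_ b_le] := entry_range_tgt sE ab.
  by rewrite !tauE //; apply: tau_entry.
- move=> j; rewrite rhoE; have [j_le|j_gt] := leqP j (omega E).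
    by rewrite !tauE ?tau_rho // (leq_trans (rho_le sE _)).
  by rewrite rho_out.
Qed.

Lemma defineP E i y :
  sound E -> live_entries E -> live E i -> entry E (i, y) = None ->
  [/\ sound (define E i y), live_entries (define E i y),
      refines E (define E i y), live (define E i y) i & entry (define E i y) (i, y)].
Proof.
move=> sE cE /andP[i_row /eqP i_fix] iy.
set n := (omega E).+1; set E1 := new_row E i y.
have def_E' : define E i y = deduction E1 i y n by [].
have sE1 := sound_new_row y sE i_row; have rhoE1 := new_row_rho i y sE.
have ny : entry E1 (n, linv y) = None by exact: (entry_out _ sE (ltnSn _)).
have i_n : i == n = false by case/andP: i_row => _ i_le; rewrite ltn_eqF.
have sE' : sound (deduction E1 i y n).
  apply: sound_deduction => //; first by case/andP: i_row => -> /leqW.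
    exact: leqnn.
  by rewrite /= eqxx -/n i_n.
have REPE' : REP (deduction E1 i y n) =1 REP E.
  by apply: REP_eq; [exact: (rho_le sE) | exact: rhoE1].
have rhoE' : rho (deduction E1 i y n) =1 rho E by exact: rhoE1.
have edge' : entry (deduction E1 i y n) (i, y) = Some n by apply: deduction_edge.
rewrite def_E'; split=> //.
- move=> a z; rewrite deduction_entry rhoE'.
  case: andP => [[/eqP-> _] _|_]; first by rewrite rho_out.
  by case: andP => [[/eqP-> _] //|_]; apply: cE.
- split.
  + exact: leqnSn.
  + by move=> j; rewrite rhoE'.
  + by move=> a b; rewrite !REPE'.
  + move=> a z b [a' [b' [ea eb e]]]; exists a', b'; rewrite !REPE'; split=> //.
    exact: deduction_sub e.
  + move=> j /andP[j_gt0]; rewrite leq_eqVlt => /predU1P[->|j_le].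
      exists i, [:: y]; split=> //=; exists n => //; exact: entry_qedge.
    by exists j, [::]; split=> //; rewrite j_gt0.
- by rewrite /live rhoE' i_fix eqxx andbT; case/andP: i_row => -> /leqW.
by rewrite edge'.
Qed.

(** * Coincidences *)

(** Weakening of [live_entries] while the row [d] is processed and the letters
    [s] of that row remain: a dead row may have entries only as long as the
    queue will still visit them. *)
Definition pending E (d : nat) (s : seq (letter g)) (Q : seq nat) : Prop :=
  forall i y, entry E (i, y) -> [\/ rho E i = i, i \in Q | i = d /\ y \in s].

Lemma pending_merge E E' d s Q Q' : entry E' = entry E ->
  (forall i, rho E i = i \/ i \in Q -> rho E' i = i \/ i \in Q') ->
  pending E d s Q -> pending E' d s Q'.
Proof.
move=> ent fixQ pE i y; rewrite ent => /pE[h|h|h]; last exact: Or33.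
- by case: (fixQ i (or_introl h)) => ?; [apply: Or31 | apply: Or32].
- by case: (fixQ i (or_intror h)) => ?; [apply: Or31 | apply: Or32].
Qed.

Lemma coincidence_letterE E Q d x e : entry E (d, x) = Some e ->
  let E1 := undefine E d x e in let E2 := update E1 d in let E3 := update E2 e in
  coincidence_letter d (E, Q) x =
    if entry E3 (REP E1 d, x) is Some c then Defs.merge (E3, Q) (REP E2 e) c
    else if entry E3 (REP E2 e, linv x) is Some c
      then Defs.merge (E3, Q) (REP E1 d) c
    else (deduction E3 (REP E1 d) x (REP E2 e), Q).
Proof. by rewrite /coincidence_letter => ->. Qed.

(** In all three cases the erased entry d^x = e survives modulo [REP].  If
    delta^x = c is present then eps and c get merged, so that entry replaces it;
    if eps^(x^-1) = c is present then delta and c get merged, and the inverse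
    entry c^x = eps replaces it; otherwise delta^x = eps is entered.  Entries are
    only added to the rows delta and eps, which are fixed by [rho]. *)
Lemma coincidence_letterP E Q d x s E' Q' :
  sound E -> pending E d (x :: s) Q ->
  coincidence_letter d (E, Q) x = (E', Q') ->
  [/\ sound E', refines E E' & pending E' d s Q'].
Proof.
move=> sE pE; case de: (entry E (d, x)) => [e|]; last first.
  rewrite /coincidence_letter de; case=> <- <-; split=> //; first exact: refines_refl.
  move=> i y iy; case: (pE i y iy) => [h|h|[i_d ys]].
  - by apply: Or31.
  - by apply: Or32.
  apply: Or33; split=> //; move: ys; rewrite in_cons => /predU1P[yx|//].
  by move: iy; rewrite i_d yx de.
rewrite (coincidence_letterE _ de).
set E1 := undefine E d x e.
have sE1 : sound E1 by apply: sound_undefine.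
set E2 := update E1 d; have sE2 : sound E2 by apply: sound_update.
set E3 := update E2 e; have sE3 : sound E3 by apply: sound_update.
have REP3 i : REP E3 i = REP E i.
  by rewrite REP_update // REP_update.
have -> : REP E1 d = REP E3 d by rewrite REP3.
have -> : REP E2 e = REP E3 e by rewrite REP3 REP_update.
set delta := REP E3 d; set eps := REP E3 e.
have fixed3 i : rho E3 i = i <-> rho E i = i.
  by rewrite update_fixed // update_fixed.
have omega3 : omega E3 = omega E by [].
have tau3 : tau E3 = tau E by [].
have entry3 a z : entry E3 (a, z) =
    if (a == e) && (z == linv x) || (a == d) && (z == x)
    then None else entry E (a, z) by rewrite -undefine_entry.
have d_row : 0 < delta <= omega E3.
  by apply: REP_range => //; apply: entry_range de.
have e_row : 0 < eps <= omega E3.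
  by apply: REP_range => //; apply: entry_range_tgt de.
have tau_d : tau E3 delta = tau E d by rewrite tau_REP.
have tau_e : tau E3 eps = tau E e by rewrite tau_REP.
have p3 : pending E3 d s Q.
  move=> i y; rewrite entry3; case: ifP => // /norP[_ n2] iy.
  case: (pE i y iy) => [h|h|[i_d ys]].
  - by apply: Or31; apply/fixed3.
  - by apply: Or32.
  apply: Or33; split=> //; move: ys; rewrite in_cons => /predU1P[yx|//].
  by case/negP: n2; rewrite i_d yx !eqxx.
(* E3 keeps all entries but the erased pair, so it suffices to recover this pair
   from an entry between the representatives. *)
have refines_from3 E4 : sound E4 -> omega E4 = omega E -> refines E3 E4 ->
    qedge E4 delta x eps -> refines E E4.
  move=> sE4 omega4 r34 edge.
  have mono i j : REP E i = REP E j -> REP E4 i = REP E4 j.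
    by move=> ij; apply: (refines_REP r34); rewrite !REP3.
  apply: refines_same_rows => // [i /(refines_fixed r34)/fixed3 //|a y b ab].
  have edge' : qedge E4 d x e.
    by apply: qedge_REP edge; apply: mono; rewrite /delta /eps REP3 (REPK (rho_le sE)).
  have := entry3 a y; case: ifP => [|_ ab3]; last first.
    by apply: (refines_qedge r34); apply: entry_qedge; rewrite ab3.
  case/orP=> /andP[/eqP ea /eqP ey] _; last by move: ab; rewrite ea ey de => -[<-].
  move: ab; rewrite ea ey (entry_sym sE de) => -[<-].
  exact: qedge_sym.
case dc: (entry E3 (delta, x)) => [c|].
  move=> mg; have omega' : omega E' = omega E := merge_omega mg.
  have [||sE' r3 REPec fixQ ent] := mergeP sE3 e_row _ _ mg.
  - exact: entry_range_tgt dc.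
  - by rewrite tau_e (tau_entry sE de) (tau_entry sE3 dc) tau_d.
  split=> //; last exact: pending_merge p3.
  apply: refines_from3 => //; have := refines_qedge r3 (entry_qedge dc).
  by apply: qedge_REP.
case ec: (entry E3 (eps, linv x)) => [c|].
  move=> mg; have omega' : omega E' = omega E := merge_omega mg.
  have [||sE' r3 REPdc fixQ ent] := mergeP sE3 d_row _ _ mg.
  - exact: entry_range_tgt ec.
  - by rewrite tau_d (tau_entry_rev sE de) (tau_entry sE3 ec) tau_e.
  split=> //; last exact: pending_merge p3.
  apply: refines_from3 => //; have := entry_sym sE3 ec; rewrite linvK => ce.
  have := refines_qedge r3 (entry_qedge ce).
  by apply: qedge_REP.
case=> <- <-.
have sE' : sound (deduction E3 delta x eps).
  by apply: sound_deduction => //; rewrite tau_d tau_e (tau_entry sE de).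
split=> //.
  apply: refines_from3 => //; first exact: refines_deduction.
  by apply: entry_qedge; rewrite deduction_edge.
move=> i y; rewrite deduction_entry.
case: andP => [[/eqP-> _] _|_]; first by apply: Or31; apply: (rho_REP (rho_le sE3)).
case: andP => [[/eqP-> _] _|_]; first by apply: Or31; apply: (rho_REP (rho_le sE3)).
exact: p3.
Qed.

Lemma coincidence_lettersP d s E Q E' Q' :
  sound E -> pending E d s Q ->
  foldl (coincidence_letter d) (E, Q) s = (E', Q') ->
  [/\ sound E', refines E E' & pending E' d [::] Q'].
Proof.
elim: s E Q => [|x s IHs] E Q sE pE.
  by case=> <- <-; split=> //; apply: refines_refl.
rewrite -[foldl _ _ _]/(foldl (coincidence_letter d)
  (coincidence_letter d (E, Q) x) s).
case e: (coincidence_letter d (E, Q) x) => [E1 Q1].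
have [sE1 r1 p1] := coincidence_letterP sE pE e.
move=> /(IHs _ _ sE1 p1)[sE' r' p']; split=> //.
exact: refines_trans r1 r'.
Qed.

Lemma coincidence_loopP EQ E' : coincidence_loop EQ E' -> sound EQ.1 ->
  (forall i y, entry EQ.1 (i, y) -> rho EQ.1 i = i \/ i \in EQ.2) ->
  [/\ sound E', refines EQ.1 E' & live_entries E'].
Proof.
elim=> {EQ E'} [E sE dE|E d Q s E' [_ s_all] _ IH sE dE] /=.
  by split=> //; [apply: refines_refl | move=> i y /dE[]].
case e: (foldl _ _ _) IH => [E1 Q1] /= IH.
have pE : pending E d s Q.
  move=> i y /dE[h|]; first exact: Or31.
  rewrite /= in_cons => /predU1P[->|h]; last exact: Or32.
  by apply: Or33; rewrite s_all.
have [sE1 r1 p1] := coincidence_lettersP sE pE e.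
case: IH => // [i y /p1[h|h|[]//]|sE' r' cE']; [by left | by right | ].
by split=> //; apply: refines_trans r1 r'.
Qed.

Lemma coincidenceP E m n E' : sound E -> live_entries E ->
  0 < m <= omega E -> 0 < n <= omega E -> tau E m = tau E n ->
  coincidence E m n E' ->
  [/\ sound E', live_entries E', refines E E' & REP E' m = REP E' n].
Proof.
move=> sE cE m_row n_row tau_mn; rewrite /coincidence.
case e: (Defs.merge (E, [::]) m n) => [E1 Q1].
have [sE1 r1 REP1 fix1 ent1] := mergeP sE m_row n_row tau_mn e.
case/coincidence_loopP => // [i y|sE' r' cE'] /=.
  by rewrite ent1 => /cE h; apply: fix1; left.
split=> //; first exact: refines_trans r1 r'.
exact: refines_REP r' _ _ REP1.
Qed.

End Tables.

(** * Scans *)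

Section Scan.
Variables (g : nat) (R : {fset relation g}).
Implicit Types (E : table R) (y : letter g) (u v w : seq (letter g)).
Implicit Types (t : presented R).

Lemma pres_act_wordK t w : pres_act_word (pres_act_word t w) (winv w) = t.
Proof.
elim: w t => // y w IHw t; rewrite winv_cons pres_act_word_cat /=.
by rewrite IHw pres_actK.
Qed.

Lemma trace_winv E a w b :
  sound E -> trace E a w = Some b -> trace E b (winv w) = Some a.
Proof.
move=> sE; elim: w a => [|y w IHw] a; first by case=> ->.
rewrite trace_cons; case ac: (entry _ _) => [c|//] /= /IHw cb.
by rewrite winv_cons trace_cat cb /= trace_cons (entry_sym sE ac).
Qed.

Lemma tau_trace E a w b : sound E -> trace E a w = Some b ->
  tau E b = omap (fun t => pres_act_word t w) (tau E a).
Proof.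
move=> sE; elim: w a => [|y w IHw] a; first by case=> ->; case: (tau E b).
rewrite trace_cons; case ac: (entry _ _) => [c|//] /= /IHw ->.
by rewrite (tau_entry sE ac); case: (tau E a).
Qed.

Lemma live_entry_tgt E a y b :
  sound E -> live_entries E -> entry E (a, y) = Some b -> live E b.
Proof.
move=> sE cE ab; have ba := entry_sym sE ab.
by rewrite /live (entry_range sE ba) (cE b (linv y)) ?ba /=.
Qed.

Lemma live_trace E a w b :
  sound E -> live_entries E -> live E a -> trace E a w = Some b -> live E b.
Proof.
move=> sE cE; elim: w a => [|y w IHw] a; first by move=> aL [<-].
rewrite trace_cons; case ac: (entry _ _) => [c|//] /= _.
exact/IHw/(live_entry_tgt sE cE ac).
Qed.

Lemma scan_forwardP E k v k1 v1 : scan_forward E k v = (k1, v1) ->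
  exists p, [/\ v = p ++ v1, trace E k p = Some k1
             & forall y u, v1 = y :: u -> entry E (k1, y) = None].
Proof.
elim: v k => /= [|y v IHv] k; first by case=> <- <-; exists [::].
case ky: (entry E (k, y)) => [c|].
  move=> /IHv[p [-> kp stop]]; exists (y :: p); split=> //.
  by rewrite trace_cons ky.
by case=> <- <-; exists [::]; split=> // z u [<- _].
Qed.

Lemma scan_backwardP E v l v1 l1 : sound E -> scan_backward E v l = (v1, l1) ->
  exists q, [/\ v = v1 ++ q, trace E l1 q = Some l
             & forall u y, v1 = rcons u y -> entry E (l1, linv y) = None].
Proof.
move=> sE; rewrite /scan_backward; case e: scan_forward => [l' v'] [<- <-].
have [p [ep lp stop]] := scan_forwardP e; exists (winv p); split.
- by rewrite -winv_cat -ep winvK.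
- exact: trace_winv.
move=> u y eu; apply: (stop _ (winv u)).
by rewrite -[v']winvK eu -cats1 winv_cat.
Qed.

Lemma live_row_range E i : live E i -> 0 < i <= omega E.
Proof. by case/andP. Qed.

Lemma define_live E i y j : live E j -> live (define E i y) j.
Proof.
case/andP=> /andP[j_gt0 j_le] fixj.
by rewrite /live /= j_gt0 (leqW j_le) (ltn_eqF (j_le : j < (omega E).+1)).
Qed.

Lemma define_tau E i y j : j <= omega E -> tau (define E i y) j = tau E j.
Proof. by move=> j_le /=; rewrite ltn_eqF. Qed.

(** The last clause excludes the empty word because a scan of it compares
    nothing.  The condition on [tau] makes the coincidence that a scan may
    discover a true one. *)
Lemma scan_loopP E k v l E' : scan_loop E k v l E' ->
  sound E -> live_entries E -> live E k -> live E l ->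
  tau E l = omap (fun t => pres_act_word t v) (tau E k) ->
  [/\ sound E', live_entries E', refines E E' & v <> [::] -> qpath E' k v l].
Proof.
(* v1 factors as p ++ v3 ++ q, where p and q are the parts read from the two
   ends; the condition on tau passes to the unread part v3, and a path for v3
   completes to one for v1. *)
have ends E1 k1 v1 l1 k2 v2 v3 l2 : sound E1 -> live_entries E1 ->
    live E1 k1 -> live E1 l1 ->
    tau E1 l1 = omap (fun t => pres_act_word t v1) (tau E1 k1) ->
    scan_forward E1 k1 v1 = (k2, v2) -> scan_backward E1 v2 l1 = (v3, l2) ->
    [/\ live E1 k2, live E1 l2,
        tau E1 l2 = omap (fun t => pres_act_word t v3) (tau E1 k2),
        (forall y u, v3 = y :: u -> entry E1 (k2, y) = None) /\
        (forall u y, v3 = rcons u y -> entry E1 (l2, linv y) = None)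
      & forall E2, refines E1 E2 -> qpath E2 k2 v3 l2 -> qpath E2 k1 v1 l1].
  move=> sE1 cE1 k1L l1L tau_kl /scan_forwardP[p [ep kp stopf]].
  move=> /(scan_backwardP sE1)[q [eq lq stopb]]; split.
  - exact: live_trace kp.
  - by apply: live_trace (trace_winv sE1 lq).
  - rewrite (tau_trace sE1 (trace_winv sE1 lq)) tau_kl (tau_trace sE1 kp) ep eq.
    case: (tau E1 k1) => //= t.
    by rewrite !pres_act_word_cat pres_act_wordK.
  - by split=> // y u e; apply: (stopf y (u ++ q)); rewrite eq e.
  move=> E2 r12 kl; rewrite ep eq.
  apply: qpath_cat (refines_qpath r12 (trace_qpath kp)) _.
  exact: qpath_cat kl (refines_qpath r12 (trace_qpath lq)).
elim=> {E k v l E'}.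
- by move=> E k l sE cE kL lL _; split=> //; apply: refines_refl.
- move=> E k v l k1 v1 y z v2 l2 E' _ ef eb _ IH sE cE kL lL tau_kl.
  have [k1L l2L tau12 [stopf _] glue] :=
    ends _ _ _ _ _ _ _ _ sE cE kL lL tau_kl ef eb.
  have [sD cD rD k1D _] := defineP sE cE k1L (stopf _ _ erefl).
  case: IH => //; first exact: define_live.
    by rewrite !define_tau //; [case/andP: k1L => /andP[] | case/andP: l2L => /andP[]].
  move=> sE' cE' r' path'; have r := refines_trans rD r'.
  by split=> // _; apply: glue => //; apply: path'.
- move=> E k v l k1 v1 y l2 _ ef eb sE cE kL lL tau_kl.
  have [k1L l2L tau12 [stopf stopb] glue] :=
    ends _ _ _ _ _ _ _ _ sE cE kL lL tau_kl ef eb.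
  have ky := stopf _ _ erefl; have ly := stopb [::] _ erefl.
  have r := refines_deduction ky ly; split=> //.
  + by apply: sound_deduction => //; apply: live_row_range.
  + move=> a x; rewrite deduction_entry.
    case: andP => [[/eqP-> _] _|_]; first by case/andP: l2L => _ /eqP.
    case: andP => [[/eqP-> _] _|_]; first by case/andP: k1L => _ /eqP.
    exact: cE.
  move=> _; apply: glue => //=; exists l2 => //.
  by apply: entry_qedge; apply: deduction_edge.
- move=> E k v l k1 v1 l2 E' _ ef eb _ co sE cE kL lL tau_kl.
  have [k1L l2L tau12 _ glue] :=
    ends _ _ _ _ _ _ _ _ sE cE kL lL tau_kl ef eb.
  have [|sE' cE' r' REP'] :=
    coincidenceP sE cE (live_row_range k1L) (live_row_range l2L) _ co.
    by rewrite tau12; case: (tau E k1).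
  by split=> // _; apply: glue.
move=> E k v l k1 v1 l2 _ ef eb e sE cE kL lL tau_kl.
have [_ _ _ _ glue] :=
    ends _ _ _ _ _ _ _ _ sE cE kL lL tau_kl ef eb.
split=> //; first exact: refines_refl.
by move=> _; apply: glue; [exact: refines_refl | rewrite e].
Qed.

Lemma live_REP E i : sound E -> 0 < i <= omega E -> live E (REP E i).
Proof. by move=> sE i_row; rewrite /live REP_range //= (rho_REP (rho_le sE)). Qed.

Lemma live_REP_id E i : sound E -> live E i -> REP E i = i.
Proof. by move=> sE /andP[_ /eqP]; apply: REP_fixed (rho_le sE) _. Qed.

Lemma gen_row E (k : 'I_g) : sound E -> 0 < k.+1 <= omega E.
Proof. by move=> sE; apply: leq_trans (ltn_ord k) (gens_range sE). Qed.

(** Scans run between the representatives of the generators at that time, but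
    paths are insensitive to [REP], so the conclusion may speak of the original
    rows of the generators.  A scan ignores an empty word; the two generators
    are then equal by hypothesis. *)
Lemma scan_primaryP s E E' :
  (forall r, r \in R -> rel_word r = 1%g -> rel_src r = rel_tgt r) ->
  {subset s <= R} -> sound E -> live_entries E -> scan_primary s E E' ->
  [/\ sound E', live_entries E', refines E E' &
      forall r, r \in s -> qpath E' (rel_src r).+1 (rel_word r) (rel_tgt r).+1].
Proof.
move=> R_empty sR sE cE run.
elim: run sR sE cE => {s E E'} [E _ sE cE|r s E E1 E2 scan1 _ IH sR sE cE].
  by split=> //; apply: refines_refl.
have rR : r \in R by apply: sR; rewrite mem_head.
have [||| sE1 cE1 r1 path1] := scan_loopP scan1 sE cE.
- by apply: live_REP => //; apply: gen_row.
- by apply: live_REP => //; apply: gen_row.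
- by rewrite !tau_REP // !tau_gen //= pres_rel_word.
case: IH => // [x xs|sE2 cE2 r2 path2]; first by apply: sR; rewrite in_cons xs orbT.
split=> //; first exact: refines_trans r1 r2.
move=> x; rewrite in_cons => /predU1P[->|/path2 //].
have [e|/eqP ne] := eqVneq (rel_word r : seq (letter g)) [::].
  by rewrite e (R_empty _ rR) //; apply: val_inj.
apply: refines_qpath r2 _; apply: (@qpath_REP _ _ E1) (path1 ne).
  by apply: refines_REP r1 _ _ _; rewrite (REPK (rho_le sE)).
by apply: refines_REP r1 _ _ _; rewrite (REPK (rho_le sE)).
Qed.

Lemma refines_live E E' i : refines E E' -> i <= omega E -> live E' i -> live E i.
Proof.
move=> r i_le /andP[/andP[i_gt0 _] /eqP/(refines_fixed r) fixi].
by rewrite /live i_gt0 i_le fixi eqxx.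
Qed.

Lemma scan_secondaryP i s E E' : {subset s <= secondary R} ->
  sound E -> live_entries E -> scan_secondary i s E E' ->
  [/\ sound E', live_entries E', refines E E' &
      live E' i -> forall w : fgroup g, w \in s -> qpath E' i w i].
Proof.
move=> sR sE cE run.
elim: run sR sE cE => {s E E'} [E|w s E /negP nL|w s E E1 E2 iL scan1 _ IH] sR sE cE.
- by split=> //; apply: refines_refl.
- by split=> //; apply: refines_refl.
have wR : w \in secondary R by apply: sR; rewrite mem_head.
have [| sE1 cE1 r1 path1] := scan_loopP scan1 sE cE iL iL.
  by case: (tau E i) => //= t; rewrite pres_secondary_word.
case: IH => // [x xs|sE2 cE2 r2 path2]; first by apply: sR; rewrite in_cons xs orbT.
split=> //; first exact: refines_trans r1 r2.
move=> i2L x; rewrite in_cons => /predU1P[->|/(path2 i2L) //].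
apply: refines_qpath r2 _; have [->|/eqP/path1 //] := eqVneq (w : seq (letter g)) [::].
by [].
Qed.

Lemma define_missingP i E s : sound E -> live_entries E -> live E i ->
  [/\ sound (define_missing i E s), live_entries (define_missing i E s),
      refines E (define_missing i E s), live (define_missing i E s) i &
      forall y, y \in s -> entry (define_missing i E s) (i, y)].
Proof.
elim: s E => [|y s IHs] E sE cE iL; first by split=> //; apply: refines_refl.
rewrite /define_missing /= -/(define_missing i _ s).
have [sE1 cE1 r1 iL1 ey] :
    let E1 := if entry E (i, y) is None then define E i y else E in
    [/\ sound E1, live_entries E1, refines E E1, live E1 i & entry E1 (i, y)].
  case e: (entry E (i, y)) => [j|]; last exact: defineP.
  by split=> //; [apply: refines_refl | rewrite e].
set E1 := (if entry E (i, y) is None then define E i y else E) in sE1 cE1 r1 iL1 ey *.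
have [sE2 cE2 r2 iL2 es] := IHs E1 sE1 cE1 iL1.
split=> //; first exact: refines_trans r1 r2.
move=> z; rewrite in_cons => /predU1P[->|/es //].
case e: (entry E1 (i, y)) ey => [j|//] _.
have [a [b [ea eb ab]]] := refines_qedge r2 (entry_qedge e).
have aL : REP (define_missing i E1 s) a = a.
  by apply: (REP_fixed (rho_le sE2)); apply: (cE2 a y); rewrite ab.
by move: ab; rewrite -aL ea (live_REP_id sE2 iL2) => ->.
Qed.

Lemma qedge_entry E a y b : sound E -> live_entries E ->
  qedge E a y b -> entry E (REP E a, y) = Some (REP E b).
Proof.
move=> sE cE [a' [b' [<- <- ab]]].
have fix_a : rho E a' = a' by apply: (cE _ y); rewrite ab.
have fix_b : rho E b' = b' by apply: (cE _ (linv y)); rewrite (entry_sym sE ab).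
by rewrite !(REP_fixed (rho_le sE)).
Qed.

Lemma qpath_trace E a w b : sound E -> live_entries E ->
  qpath E a w b -> trace E (REP E a) w = Some (REP E b).
Proof.
move=> sE cE; elim: w a => [|y w IHw] a /=; first by move->.
by move=> [c ac cb]; rewrite trace_cons (qedge_entry sE cE ac) /= IHw.
Qed.

(** * The main loop *)

Definition processed E j : Prop :=
  (forall y, entry E (j, y)) /\
  (forall w : fgroup g, w \in secondary R -> qpath E j w j).

(** A later coincidence may move the entries of a live row but cannot empty
    them: the quotient keeps them, and a live row is its own representative. *)
Lemma processed_refines E E' j : sound E' -> live_entries E' -> refines E E' ->
  live E' j -> processed E j -> processed E' j.
Proof.
move=> sE' cE' r jL [complete_j secondary_j]; split=> [y|w /secondary_j]; last first.
  exact: refines_qpath.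
have := complete_j y; case e: (entry E (j, y)) => [b|//] _.
have := qedge_entry sE' cE' (refines_qedge r (entry_qedge e)).
by rewrite (live_REP_id sE' jL) => ->.
Qed.

Lemma max_live_le E : max_live E <= omega E.
Proof. by apply/bigmax_leqP => i _; rewrite -ltnS. Qed.

Lemma live_le_max E i : live E i -> i <= max_live E.
Proof.
move=> iL; have i_lt : i < (omega E).+1 by case/andP: iL => /andP[].
exact: (@leq_bigmax_cond _ _ (fun i : 'I_(omega E).+1 => i : nat) (Ordinal i_lt)).
Qed.

Lemma main_loopP M i E i' E' : main_loop M i E i' E' ->
  sound E -> live_entries E -> (forall j, j < i -> live E j -> processed E j) ->
  [/\ sound E', live_entries E', refines E E' &
      forall j, j < i' -> live E' j -> processed E' j].
Proof.
elim=> {i E i' E'}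
  [i E _|i E s t E1 i' E' i_max _ [_ s_all] sec [_ t_all] _ IH] sE cE proc.
  by split=> //; apply: refines_refl.
have [|sE1 cE1 r1 sec1] := scan_secondaryP _ sE cE sec.
  by move=> w; rewrite s_all.
set E2 := (if _ then _ else _) in IH.
have [sE2 cE2 r2 proc_i] : [/\ sound E2, live_entries E2, refines E1 E2 &
    live E2 i -> processed E2 i].
  rewrite /E2; case: ifP => iL1; last first.
    by split=> //; [apply: refines_refl | rewrite iL1].
  have [sD cD rD iD compl] := define_missingP t sE1 cE1 iL1.
  split=> // _; split=> [y|w wR]; first by apply: compl; rewrite t_all.
  by apply: refines_qpath rD _; apply: sec1 => //; rewrite s_all.
have r02 := refines_trans r1 r2.
case: IH => // [j|sE' cE' r' proc'].
  rewrite ltnS leq_eqVlt => /predU1P[->|j_i] // jL.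
  apply: (processed_refines sE2 cE2 r02 jL); apply: proc => //.
  apply: refines_live r02 _ jL.
  exact: leq_trans (leq_trans (ltnW j_i) i_max) (max_live_le E).
by split=> //; apply: refines_trans r02 r'.
Qed.

Lemma sound_init : sound (init R).
Proof.
split=> //= [k|[|i] //= i_lt].
  by rewrite valK.
by rewrite insubT.
Qed.

(** What the proof retains of a completed run. *)
Record enumerated E : Prop := Enumerated {
  enum_sound : sound E;
  enum_live_entries : live_entries E;
  enum_refines : refines (init R) E;
  enum_primary : forall r, r \in R ->
    qpath E (rel_src r).+1 (rel_word r) (rel_tgt r).+1;
  enum_processed : forall i, live E i -> processed E i
}.

Lemma enumerateP M E :
  (forall r, r \in R -> rel_word r = 1%g -> rel_src r = rel_tgt r) ->
  enumerate_completes M E -> enumerated E.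
Proof.
move=> R_empty [s [E1 [i [[_ s_all] prim main i_max]]]].
have [x|//|sE1 cE1 r1 prim1] := scan_primaryP R_empty _ sound_init _ prim.
  by rewrite s_all.
have [|sE cE r proc] := main_loopP main sE1 cE1.
  by case=> // j; rewrite ltn0 => _ /andP[].
split=> //.
- exact: refines_trans r1 r.
- by move=> x xR; apply: refines_qpath r _; apply: prim1; rewrite s_all.
by move=> j jL; apply: proc => //; apply: leq_ltn_trans (live_le_max jL) i_max.
Qed.

End Scan.

(** * The rack carried by a complete table *)

Section CompleteTable.
Variables (g : nat) (R : {fset relation g}) (E : table R).
Hypothesis enumE : enumerated E.
Implicit Types (i j : live_row E) (y : letter g) (u v w : seq (letter g)).
Implicit Types (a b c : fgroup g) (x z : free_rack g).

Let sE : sound E := enum_sound enumE.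
Let lE : live_entries E := enum_live_entries enumE.

Definition pi_pres x : presented R := (\pi_(presented R) x)%qT.

Lemma step_key i y : {j : live_row E | entry E (sval i, y) = Some (sval j)}.
Proof.
case e: (entry E (sval i, y)) => [k|].
  by exists (exist _ k (live_entry_tgt sE lE e)).
by have [/(_ y)] := enum_processed enumE (svalP i); rewrite e.
Qed.

Definition step i y : live_row E := sval (step_key i y).
Definition act i w : live_row E := foldl step i w.

Lemma trace_act i w : trace E (sval i) w = Some (sval (act i w)).
Proof.
elim: w i => // y w IHw i; rewrite trace_cons.
by rewrite (svalP (step_key i y)) /= IHw.
Qed.

Lemma act_trace i w k : trace E (sval i) w = Some k -> sval (act i w) = k.
Proof. by rewrite trace_act => -[]. Qed.

Lemma stepK i y : step (step i y) (linv y) = i.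
Proof.
apply: val_inj; have /(entry_sym sE) := svalP (step_key i y).
by rewrite (svalP (step_key (step i y) (linv y))) => -[].
Qed.

Lemma act_cat i u v : act i (u ++ v) = act (act i u) v.
Proof. exact: foldl_cat. Qed.

Lemma act_cons_reduced i y w : act i (cons_reduced y w) = act (step i y) w.
Proof. by case: w => //= z w; case: eqP => [->|//]; rewrite /= stepK. Qed.

Lemma act_reduce i w : act i (reduce w) = act i w.
Proof. by elim: w i => //= y w IHw i; rewrite act_cons_reduced IHw. Qed.

Lemma actM i a b : act i (a * b)%g = act (act i a) b.
Proof. by rewrite /= act_reduce act_cat. Qed.

Lemma actK i a : act (act i a) a^-1%g = i.
Proof. by rewrite -actM mulgV. Qed.

Lemma actVK i a : act (act i a^-1%g) a = i.
Proof. by rewrite -actM mulVg. Qed.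

Lemma act_secondary i a : a \in secondary R -> act i a = i.
Proof.
move=> aR; apply: val_inj; apply: act_trace.
have [_ /(_ a aR)/(qpath_trace sE lE)] := enum_processed enumE (svalP i).
by rewrite (live_REP_id sE (svalP i)).
Qed.

Definition gen_live (k : 'I_g) : live_row E :=
  exist _ (REP E k.+1) (live_REP sE (gen_row k sE)).

(** A map from the free rack to live rows; it will be seen to induce the inverse
    of [tau]. *)
Definition row x : live_row E := act (gen_live x.1) x.2.

(** Acting by the symbol a^u on a rack generated by S is acting by this word. *)
Definition rack_word x : fgroup g := (x.2^-1 * fgen x.1 * x.2)%g.

Lemma row_op x z : row (fr_op x z) = act (row x) (rack_word z).
Proof. by rewrite /row /fr_op /rack_word !actM. Qed.

Lemma row_opi x z : row (fr_opi x z) = act (row x) (rack_word z)^-1%g.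
Proof. by rewrite /row /fr_opi /rack_word !invgM invgK !actM. Qed.

Lemma rack_word_op x z :
  rack_word (fr_op x z) = ((rack_word z)^-1 * rack_word x * rack_word z)%g.
Proof. by rewrite /rack_word /fr_op /= !invgM !invgK !mulgA. Qed.

Lemma rack_word_opi x z :
  rack_word (fr_opi x z) = (rack_word z * rack_word x * (rack_word z)^-1)%g.
Proof. by rewrite /rack_word /fr_opi /= !invgM !invgK !mulgA. Qed.

Definition same_act a b : Prop := forall i, act i a = act i b.

Lemma same_actM a a' b b' :
  same_act a a' -> same_act b b' -> same_act (a * b)%g (a' * b')%g.
Proof. by move=> aa bb i; rewrite !actM aa bb. Qed.

Lemma same_actV a b : same_act a b -> same_act a^-1%g b^-1%g.
Proof. by move=> ab i; rewrite -{1}[i](actVK i b) -ab actK. Qed.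

(** Equality of rows alone is not visibly a congruence, since the action of a
    row is not yet known to depend on the row only; the second clause adds
    exactly what [row_op] and [row_opi] require. *)
Definition row_cong x z : Prop :=
  row x = row z /\ same_act (rack_word x) (rack_word z).

Lemma row_congP : is_congruence (@fr_op g) (@fr_opi g) row_cong.
Proof.
split=> [x|x z [rx cx]|z x t [rx cx] [rz cz]|x x' z z' [rx cx] [rz cz]|
  x x' z z' [rx cx] [rz cz]].
- by split=> // i.
- by split=> // i; rewrite cx.
- by split=> [|i]; [rewrite rx | rewrite cx].
- split; first by rewrite !row_op rx cz.
  rewrite !rack_word_op; apply: same_actM => //.
  by apply: same_actM => //; apply: same_actV.
- split; first by rewrite !row_opi rx (same_actV cz).
  rewrite !rack_word_opi; apply: same_actM; last exact: same_actV.
  exact: same_actM.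
Qed.

(** The words u^-1 x_i u and x_j differ by the secondary word
    u^-1 x_i u x_j^-1, which fixes every live row. *)
Lemma row_cong_rel r : r \in R -> row_cong r.1 (fr_gen (rel_tgt r)).
Proof.
move=> rR; split.
  apply: val_inj; apply: act_trace.
  have /(qpath_trace sE lE) := enum_primary enumE rR.
  by [].
move=> i; set c := rack_word r.1.
have -> : rack_word (fr_gen (rel_tgt r)) = fgen (rel_tgt r).
  by rewrite /rack_word invg1 mul1g mulg1.
have cR : (c * (fgen (rel_tgt r))^-1)%g \in secondary R by apply: in_imfset.
by rewrite -[in RHS](act_secondary i cR) -actM mulgVK.
Qed.

(** The defining congruence is the least one containing the relations. *)
Lemma pi_pres_row_cong x z : pi_pres x = pi_pres z -> row_cong x z.
Proof.
by move=> /pres_piP/(_ _ row_congP); apply; apply: row_cong_rel.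
Qed.

Lemma tau_key i : {t | tau E (sval i) = Some t}.
Proof.
have := tau_row sE (live_row_range (svalP i)).
by case: (tau E (sval i)) => // t _; exists t.
Qed.

Definition tau_live i : presented R := sval (tau_key i).

Lemma tau_liveP i : tau E (sval i) = Some (tau_live i).
Proof. exact: (svalP (tau_key i)). Qed.

Lemma tau_row_pi x : tau_live (row x) = pi_pres x.
Proof.
have := tau_trace sE (trace_act (gen_live x.1) x.2).
rewrite tau_liveP (tau_REP _ sE) (tau_gen sE) /= => -[->].
by rewrite pres_act_word_gen -surjective_pairing.
Qed.

Lemma row_gen_trace (k : 'I_g) a j :
  live E k.+1 -> trace E k.+1 a = Some (sval j) -> row (k, a) = j.
Proof.
move=> kL kj; apply: val_inj; apply: act_trace.
by rewrite /= (live_REP_id sE kL).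
Qed.

(** A row k <= g that reaches j modulo [REP] may be dead, but its
    representative is live, at most k, and reaches j in the table itself. *)
Lemma live_row_reached j :
  exists (k : 'I_g) a, live E k.+1 /\ trace E k.+1 a = Some (sval j).
Proof.
have [k [w [k_row kj]]] :=
  refines_reach (enum_refines enumE) (live_row_range (svalP j)).
have{k_row} k_row : 0 < k <= g by [].
have k_rowE : 0 < k <= omega E.
  by case/andP: k_row => -> /leq_trans -> //; apply: gens_range sE.
have kL := live_REP sE k_rowE; have k_le := REP_le (rho_le sE) k.
have := qpath_trace sE lE kj; rewrite (live_REP_id sE (svalP j)).
case: (REP E k) k_le kL => [|m] m_lt mL; first by case/andP: mL.
have lt_m : m < g by case/andP: k_row => _; apply: leq_trans.
move=> mj; exists (Ordinal lt_m), (fg_of w); split=> //.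
have /= := act_trace (i := exist _ m.+1 mL) mj.
by rewrite -act_reduce => {1}<-; rewrite -(trace_act (exist _ m.+1 mL)).
Qed.

Lemma row_surj j : exists x, row x = j.
Proof.
by have [k [a [kL kj]]] := live_row_reached j; exists (k, a); apply: row_gen_trace.
Qed.

Lemma tau_live_inj : injective tau_live.
Proof.
move=> i j; have [x <-] := row_surj i; have [z <-] := row_surj j.
by rewrite !tau_row_pi => /pi_pres_row_cong[].
Qed.

(** The choice of the representative of [tau j] is immaterial for the action, by
    [live_word_row]. *)
Definition live_word j : fgroup g := rack_word (repr (tau_live j)).

Lemma live_word_row x : same_act (live_word (row x)) (rack_word x).
Proof. by rewrite /live_word tau_row_pi; apply: (pi_pres_row_cong _).2; apply: reprK. Qed.

Definition live_op i j : live_row E := act i (live_word j).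
Definition live_opi i j : live_row E := act i (live_word j)^-1%g.

Lemma tau_live_op : {morph tau_live : i j / live_op i j >-> pres_op i j}.
Proof.
move=> i j; have [x <-] := row_surj i; have [z <-] := row_surj j.
by rewrite /live_op live_word_row -row_op !tau_row_pi; apply: pi_pres_op.
Qed.

Lemma tau_live_opi : {morph tau_live : i j / live_opi i j >-> pres_opi i j}.
Proof.
move=> i j; have [x <-] := row_surj i; have [z <-] := row_surj j.
rewrite /live_opi (same_actV (live_word_row z)) -row_opi !tau_row_pi.
exact: pi_pres_opi.
Qed.

Lemma tau_live_bij : bijective tau_live.
Proof.
have rowK : cancel (fun t => row (repr t)) tau_live.
  by move=> t; rewrite tau_row_pi; apply: reprK.
by exists (fun t => row (repr t)) => // i; apply: tau_live_inj.
Qed.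

Lemma live_rack : is_rack live_op live_opi.
Proof.
have [opK opiK opD] := presentedP R.
split=> [i j|i j|i j k]; apply: tau_live_inj;
  by rewrite !(tau_live_op, tau_live_opi) ?(opK, opiK) // opD.
Qed.

End CompleteTable.

Theorem theorem4p2 (g : nat) (R : {fset relation g}) (M : nat) (E : table R)
    (M_gt0 : 0 < M)
    (R_empty_word : forall r, r \in R ->
       rel_word r = 1%g -> rel_src r = rel_tgt r)
    (E_returned : enumerate_completes M E) :
  (forall j : live_row E, exists (k : 'I_g) (w : fgroup g),
     live E k.+1 /\ trace E k.+1 w = Some (sval j)) /\
  exists op opi : live_row E -> live_row E -> live_row E,
    [/\ (forall (i j : live_row E) (k : 'I_g) (w : fgroup g),
           live E k.+1 -> trace E k.+1 w = Some (sval j) ->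
           trace E (sval i) (w^-1 * fgen k * w)%g = Some (sval (op i j))),
        (forall (i j : live_row E) (k : 'I_g) (w : fgroup g),
           live E k.+1 -> trace E k.+1 w = Some (sval j) ->
           trace E (sval i) (w^-1 * (fgen k)^-1 * w)%g = Some (sval (opi i j))),
        is_rack op opi
      & exists tau_live : live_row E -> presented R,
          (forall i : live_row E, tau E (sval i) = Some (tau_live i)) /\
          is_rack_isomorphism op opi (@pres_op g R) (@pres_opi g R) tau_live].
Proof.
have enumE := enumerateP R_empty_word E_returned.
split; first exact: live_row_reached enumE.
exists (live_op enumE), (live_opi enumE); split.
- move=> i j k w kL kj; rewrite (trace_act enumE).
  by rewrite -(row_gen_trace enumE kL kj) /live_op live_word_row.
- move=> i j k w kL kj.
  have -> : (w^-1 * (fgen k)^-1 * w = (rack_word (k, w))^-1)%g.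
    by rewrite /rack_word !invgM invgK mulgA.
  rewrite (trace_act enumE) -(row_gen_trace enumE kL kj) /live_opi.
  by rewrite (same_actV (live_word_row enumE (k, w))).
- exact: live_rack.
exists (tau_live enumE); split; first exact: tau_liveP.
split; [exact: tau_live_bij | exact: tau_live_op | exact: tau_live_opi].
Qed.
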